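(* Let $a,b$ be integers with $3\le a<b$, and let $G$ be a graph of order $n\ge 2b^2+4b$. If $\rho(G)\ge \rho(H_{n,b})$, then $G$ has all $[a,b]$-factors unless $G\cong H_{n,b}$.
   Context: All graphs are finite, undirected and simple. $\rho(G)$ denotes the spectral radius (largest eigenvalue of the adjacency matrix) of $G$. For graphs $G_1,G_2$, the join $G_1\nabla G_2$ is obtained from the disjoint union $G_1\cup G_2$ by adding all edges between $V(G_1)$ and $V(G_2)$. For integers $2\le b\le n-1$, $H_{n,b}:=K_{b-1}\nabla(K_1\cup K_{n-b})$. For a function $h:V(G)\to\mathbb{Z}^+$, an $h$-factor of $G$ is a spanning subgraph $F$ with $d_F(v)=h(v)$ for all $v\in V(G)$. For positive integers $a\le b$, $G$ has all $[a,b]$-factors if $G$ has an $h$-factor for every function $h:V(G)\to\mathbb{Z}^+$ with $a\le h(v)\le b$ for all $v\in V(G)$ and $\sum_{v\in V(G)}h(v)\equiv 0 \pmod 2$. *)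

(* Defs.v *)
From mathcomp Require Import all_boot all_order all_algebra.
Set Implicit Arguments. Unset Strict Implicit. Unset Printing Implicit Defensive.
Import Order.TTheory GRing.Theory Num.Theory.

Definition simple_graph (n : nat) (G : rel 'I_n) : Prop :=
  symmetric G /\ irreflexive G.

Definition adjmx (R : fieldType) (n : nat) (G : rel 'I_n) : 'M[R]_n :=
  \matrix_(i, j) ((G i j)%:R)%R.

Definition spectral_radius (R : rcfType) (n : nat) (G : rel 'I_n) (r : R) : Prop :=
  eigenvalue (adjmx R G) r /\
  (forall x : R, eigenvalue (adjmx R G) x -> (x <= r)%R).

(* H_{n,b} = K_{b-1} \join (K_1 \cup K_{n-b}) on 'I_n:
   vertices 0..b-2 form K_{b-1}, vertex b-1 is K_1, vertices b..n-1 form K_{n-b}. *)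
Definition Hnb (n b : nat) : rel 'I_n :=
  fun i j => (i != j) && [|| (i < b.-1)%N, (j < b.-1)%N | (b <= i)%N && (b <= j)%N].

Definition graph_iso (n : nat) (G H : rel 'I_n) : Prop :=
  exists f : 'I_n -> 'I_n, bijective f /\ forall x y, G x y = H (f x) (f y).

Definition is_h_factor (n : nat) (G : rel 'I_n) (h : 'I_n -> nat) (F : rel 'I_n) : Prop :=
  simple_graph F /\ (forall x y, F x y -> G x y) /\
  (forall v, #|[set u | F v u]| = h v).

Definition all_factors (n : nat) (G : rel 'I_n) (a b : nat) : Prop :=
  forall h : 'I_n -> nat,
    (forall v, 0 < h v)%N ->
    (forall v, a <= h v <= b)%N ->
    ~~ odd (\sum_(v : 'I_n) h v)%N ->
    exists F : rel 'I_n, is_h_factor G h F.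

(* Main.v *)
Require Import Defs.
From mathcomp Require Import all_boot all_order all_algebra.
From mathcomp Require Import zify ring lra.
Import Order.TTheory GRing.Theory Num.Theory.

Set Implicit Arguments. Unset Strict Implicit. Unset Printing Implicit Defensive.

(* H_{n,b} has an eigenvalue l >= n - 2 with a positive eigenvector w.  If G had
   a vertex of degree less than b, it would embed in H_{n,b}; pairing w with |v|,
   for v an eigenvector of G, then gives rho(G) <= l, and equality forces
   G = H_{n,b}.  So G has minimum degree at least b, and Hong's bound
   rho(G)^2 <= 2 e(G) - n + 1 leaves at most n - 2 edges in the complement.

   Let z be a vertex of minimum degree.  Join z to any h(z) of its neighbours;
   it remains to find a factor of G - z for a demand between 2 and b.  In G - z
   no vertex misses more than about n/2 others, and a partial factor with
   deficient vertices x and y can be augmented, either by one edge or along a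
   trail x - p - q - r - s - y whose edges alternate between G \ F and F. *)

(** * Partial factors and augmenting trails *)

Section Degree.
Variable T : finType.
Implicit Types F G : rel T.

Definition degree F v := #|[set u | F v u]|.

Lemma degreeE F v : degree F v = \sum_u (F v u : nat).
Proof. by rewrite /degree cardsE -sum1_card big_mkcond. Qed.

(** Exclusive or makes adding and deleting an edge one operation, so switching a trail is a
    composition of toggles. *)
Definition toggle F u v : rel T :=
  fun i j => F i j (+) ((i == u) && (j == v) || (i == v) && (j == u)).

Lemma toggle_sym F u v : symmetric F -> symmetric (toggle F u v).
Proof.
move=> sF i j; rewrite /toggle sF; congr addb.
by rewrite orbC [(j == v) && _]andbC [(j == u) && _]andbC.
Qed.

Lemma degree_toggle F u v i : symmetric F -> u != v ->
  if F u v then degree F i = degree (toggle F u v) i + ((i == u) + (i == v))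
  else degree (toggle F u v) i = degree F i + ((i == u) + (i == v)).
Proof.
move=> sF uv.
have E : (i == u) + (i == v) =
    \sum_j ((i == u) && (j == v) || (i == v) && (j == u) : nat).
  transitivity (\sum_j (((i == u) && (j == v)) + ((i == v) && (j == u)) : nat)).
    rewrite big_split /=; congr (_ + _).
      rewrite (bigD1 v) //= eqxx andbT big1 ?addn0 // => j /negPf ->.
      by rewrite andbF.
    rewrite (bigD1 u) //= eqxx andbT big1 ?addn0 // => j /negPf ->.
    by rewrite andbF.
  apply: eq_bigr => j _; case: (i =P u) => [->|_] //=; rewrite (negPf uv) /=.
  by rewrite addn0 orbF.
case: ifP => Fuv; rewrite !degreeE E -big_split /=; apply: eq_bigr => j _;
  rewrite /toggle; (case: (boolP (_ && _ || _)) => [/orP[]/andP[/eqP-> /eqP->]|_];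
    last by rewrite addbF addn0); by rewrite 1?[F v u]sF Fuv.
Qed.

Lemma toggleE F u v i j : ~~ ((i == u) && (j == v) || (i == v) && (j == u)) ->
  toggle F u v i j = F i j.
Proof. by move/negPf => E; rewrite /toggle E addbF. Qed.

Lemma toggle_sub F G u v : symmetric G -> G u v ->
  (forall i j, F i j -> G i j) -> forall i j, toggle F u v i j -> G i j.
Proof.
move=> sG Guv FG i j; rewrite /toggle.
case: (boolP (_ || _)) => [/orP[]/andP[/eqP-> /eqP->] _|_] //; first by rewrite sG.
by rewrite addbF; apply: FG.
Qed.

(* Adding [xp], [qr], [sy] and deleting [pq], [rs] changes only the degrees of
   the two ends. *)
Lemma toggle_trail F G x y p q r s : symmetric F -> symmetric G ->
  irreflexive G -> (forall i j, F i j -> G i j) ->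
  G x p -> ~~ F x p -> F p q -> G q r -> ~~ F q r -> F r s -> G s y ->
  ~~ F s y -> (x != y) && ~~ (G x y && ~~ F x y) || (x == y) && (p != s) ->
  exists F', [/\ symmetric F', forall i j, F' i j -> G i j &
    forall v, degree F' v = degree F v + ((v == x) + (v == y))].
Proof.
move=> sF sG iG FG Gxp Fxp Fpq Gqr Fqr Frs Gsy Fsy H.
have ne a c : G a c -> a != c by case: eqP => // ->; rewrite iG.
have Gpq := FG _ _ Fpq; have Grs := FG _ _ Frs.
(* Deleted edges lie in [F] and added ones do not, so below only edges of the same kind have to be
   told apart. *)
have dis a c d e : F a c -> ~~ F d e -> ~~ ((a == d) && (c == e) || (a == e) && (c == d)).
  move=> Fac Fde; apply/negP => /orP[]/andP[/eqP A /eqP B]; subst;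
    by move: Fde; rewrite ?Fac // sF Fac.
have dis' a c d e : F a c -> ~~ F d e -> ~~ ((d == a) && (e == c) || (d == c) && (e == a)).
  move=> Fac Fde; apply/negP => /orP[]/andP[/eqP A /eqP B]; subst;
    by move: Fde; rewrite ?Fac // sF Fac.
pose F1 := toggle F x p; pose F2 := toggle F1 p q; pose F3 := toggle F2 q r.
pose F4 := toggle F3 r s; pose F5 := toggle F4 s y.
have s1 : symmetric F1 by apply: toggle_sym.
have s2 : symmetric F2 by apply: toggle_sym.
have s3 : symmetric F3 by apply: toggle_sym.
have s4 : symmetric F4 by apply: toggle_sym.
have s5 : symmetric F5 by apply: toggle_sym.
exists F5; split => //.
  by do 5! [apply: toggle_sub => //].
have F1pq : F1 p q by rewrite /F1 toggleE // dis.
have F2qr : F2 q r = false.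
  rewrite /F2 toggleE ?dis' //  /F1 toggleE ?(negPf Fqr) //.
  apply/negP => /orP[]/andP[/eqP A /eqP B]; subst; last by rewrite iG in Gpq.
  by move: Fxp; rewrite sF Fpq.
have F3rs : F3 r s = true.
  rewrite /F3 toggleE ?dis // /F2 toggleE.
    by rewrite /F1 toggleE ?dis.
  apply/negP => /orP[]/andP[/eqP A /eqP B]; subst.
    by move: Fqr; rewrite sF Frs.
  by rewrite iG in Gqr.
(* Here [H] enters: it keeps the last edge [sy] from being the first edge [xp], in either
   orientation. *)
have F4sy : F4 s y = false.
  rewrite /F4 toggleE ?dis' // /F3 toggleE.
    rewrite /F2 toggleE ?dis' // /F1 toggleE ?(negPf Fsy) //.
    apply/negP => /orP[]/andP[/eqP A /eqP B]; subst.
      by move: H; rewrite Gxp Fxp andbF /= (negPf (ne _ _ Gxp)).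
    by move: H; rewrite !eqxx.
  apply/negP => /orP[]/andP[/eqP A /eqP B]; subst.
    by move: Fsy; rewrite sF Frs.
  by rewrite iG in Grs.
move=> v.
have := degree_toggle v s4 (ne _ _ Gsy); rewrite F4sy -/F5.
have := degree_toggle v s3 (ne _ _ Grs); rewrite F3rs -/F4.
have := degree_toggle v s2 (ne _ _ Gqr); rewrite F2qr -/F3.
have := degree_toggle v s1 (ne _ _ Gpq); rewrite F1pq -/F2.
have := degree_toggle v sF (ne _ _ Gxp); rewrite (negPf Fxp) -/F1.
move: (nat_of_bool (v == x)) (nat_of_bool (v == y)) (nat_of_bool (v == p))
  (nat_of_bool (v == q)) (nat_of_bool (v == r)) (nat_of_bool (v == s)).
move: (degree F v) (degree F1 v) (degree F2 v) (degree F3 v) (degree F4 v) (degree F5 v).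
by clear; lia.
Qed.

Definition nbhd F (P : {set T}) := [set q | [exists p in P, F p q]].

(** Double counting: every [F]-edge leaving [P] ends in [nbhd F P], and each vertex there receives
    at most [b] of them. *)
Lemma card_nbhd F (P : {set T}) b : symmetric F -> (forall v, degree F v <= b) ->
  \sum_(p in P) degree F p <= b * #|nbhd F P|.
Proof.
move=> sF db.
under eq_bigr do rewrite degreeE.
rewrite exchange_big (bigID (mem (nbhd F P))) /= [X in _ + X]big1 ?addn0; last first.
  move=> q; rewrite inE negb_exists => /forallP Hq; apply: big1 => p pP.
  by move: (Hq p); rewrite pP /= => /negPf ->.
rewrite mulnC -sum_nat_const; apply: leq_sum => q _.
apply: leq_trans (db q); rewrite degreeE [X in _ <= X](bigID (mem P)) /=.
by apply: leq_trans (leq_addr _ _);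
  rewrite leq_eqVlt; apply/orP; left; apply/eqP; apply: eq_bigr => p _; rewrite sF.
Qed.
End Degree.

(* In this section [z] is a vertex already dealt with: it is isolated in [G] and
   has demand 0. *)
Section Dense.
Variables (T : finType) (G : rel T) (h : T -> nat) (z : T) (b D : nat).

(** The degree in the complement of [G - z]. *)
Definition codegree v := #|[set u | [&& u != v, u != z & ~~ G v u]]|.

Definition subfactor F := [/\ symmetric F, forall u v, F u v -> G u v &
  forall v, degree F v <= h v].

Hypotheses (sG : symmetric G) (iG : irreflexive G) (Gz : forall v, G z v = false).
Hypotheses (hz : h z = 0) (hb : forall v, v != z -> 2 <= h v <= b).
Hypotheses (b2 : 2 <= b) (nb : 2 * b ^ 2 + 4 * b <= #|T|).
(** In the application [D] is the number of non-neighbours of [z] in the original graph, so [D.*2]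
    restores to the degree sum of the complement the edges lost with [z]. *)
Hypotheses (cD : forall v, v != z -> codegree v <= D)
  (sumc : \sum_(v | v != z) codegree v + D.*2 + 3 <= #|T|.*2).

(** The 2 accounts for [v] and [z]. *)
Lemma degree_codegree v : v != z -> degree G v + codegree v + 2 = #|T|.
Proof.
move=> vz; rewrite -(cardsC [set u | G v u]) -/(degree G v) -addnA; congr (_ + _).
rewrite (cardsD1 v) (cardsD1 z (_ :\ v)) !inE iG sG Gz eq_sym vz /=.
rewrite !add1n addn2; congr _.+2.
by apply: eq_card => u; rewrite !inE andbCA.
Qed.

(** Each complement edge at [x] enters the sum of [sumc] twice, at [x] and at its other end. *)
Lemma codegree2 x : x != z -> (codegree x).*2 + D.*2 + 3 <= #|T|.*2.
Proof.
move=> xz; apply: leq_trans sumc; rewrite leq_add2r leq_add2r.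
rewrite (bigD1 x) //= -addnn leq_add2l.
rewrite {1}/codegree -sum1_card (eq_bigl (fun u => [&& u != z, u != x & ~~ G x u])); last first.
  by move=> u; rewrite inE andbCA.
under eq_bigl do rewrite andbA.
rewrite big_mkcondr; apply: leq_sum => u /andP[uz ux]; case: ifP => // Gxu.
rewrite /codegree (cardsD1 x) inE eq_sym ux xz /= sG Gxu; exact: leq_addr.
Qed.

Lemma subfactor_add F x y : subfactor F -> G x y -> ~~ F x y ->
  degree F x < h x -> degree F y < h y ->
  exists2 F', subfactor F' & \sum_v degree F' v = \sum_v degree F v + 2.
Proof.
move=> [sF FG dF] Gxy Fxy hx hy; have xy : x != y by apply: contraTneq Gxy => ->; rewrite iG.
have E v := degree_toggle v sF xy; rewrite (negPf Fxy) in E.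
exists (toggle F x y); first split.
- exact: toggle_sym.
- exact: toggle_sub.
- move=> v; rewrite E; have := dF v; have [->|_] := eqVneq v x.
    by rewrite (negPf xy); lia.
  by have [->|_] := eqVneq v y; lia.
under eq_bigr do rewrite E; rewrite big_split big_split /=; congr (_ + _).
by rewrite -!big_mkcond !sum1_card !card1.
Qed.

(** The term [(x == y)] demands deficiency two when both ends coincide. If no single edge can be
    added at [x] or [y], all vertices of [P x] and [P y] are saturated. Their [F]-neighbourhoods are
    then so large that some [q] in the first and [r] in the second are joined by an edge of [G]
    outside [F], which completes the trail. *)
Lemma subfactor_augment F x y : subfactor F ->
  degree F x + 1 + (x == y) <= h x -> degree F y + 1 + (x == y) <= h y ->
  exists2 F', subfactor F' & \sum_v degree F' v = \sum_v degree F v + 2.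
Proof.
move=> vF hx hy; have [sF FG dF] := vF.
have hx' : degree F x < h x by lia.
have hy' : degree F y < h y by lia.
have [/existsP[p /andP[/andP[Gxp Fxp] hp]]|noadd] :=
  boolP [exists p, G x p && ~~ F x p && (degree F p < h p)].
  exact: subfactor_add Gxp Fxp hx' hp.
have [/existsP[p /andP[/andP[Gyp Fyp] hp]]|noaddy] :=
  boolP [exists p, G y p && ~~ F y p && (degree F p < h p)].
  exact: subfactor_add Gyp Fyp hy' hp.
have nz w : degree F w < h w -> w != z by move=> ?; apply/eqP => w0; subst w; lia.
have xz := nz _ hx'; have yz := nz _ hy'.
have dFb v : degree F v <= b.
  by apply: leq_trans (dF v) _; have [->|/hb] := eqVneq v z; lia.
pose P w := [set p | G w p && ~~ F w p].
have satx p : p \in P x -> degree F p = h p.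
  rewrite inE => Pp; apply/eqP; rewrite eqn_leq dF /= leqNgt.
  by apply: contra noadd => hp; apply/existsP; exists p; rewrite Pp.
have saty p : p \in P y -> degree F p = h p.
  rewrite inE => Pp; apply/eqP; rewrite eqn_leq dF /= leqNgt.
  by apply: contra noaddy => hp; apply/existsP; exists p; rewrite Pp.
have Pz w p : p \in P w -> p != z.
  by rewrite inE => /andP[Gp _]; apply: contraTneq Gp => ->; rewrite sG Gz.
have cardP w : w != z -> degree F w < h w -> #|T| <= #|P w| + codegree w + b + 1.
  move=> wz hw; have : degree G w = #|P w| + degree F w.
    rewrite /degree -[in LHS](cardsID [set u | F w u]) addnC; congr (_ + _).
      by apply: eq_card => u; rewrite !inE andbC.
    by apply: eq_card => u; rewrite !inE andbC; case: (boolP (F w u)) => // /FG ->.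
  by have := degree_codegree wz; have := hb wz; lia.
(* A saturated vertex other than [z] has at least two [F]-edges, because its demand is at least
   2. *)
have nbP (S : {set T}) : (forall p, p \in S -> p != z /\ degree F p = h p) ->
    2 * #|S| <= b * #|nbhd F S|.
  move=> HS; apply: leq_trans (card_nbhd _ sF dFb).
  rewrite mulnC -sum_nat_const; apply: leq_sum => p /HS[/hb hp ->]; lia.
have Px := cardP x xz hx'; have Py := cardP y yz hy'.
have cx := codegree2 xz; have cy := codegree2 yz.
have cxD := cD xz; have cyD := cD yz.
have PPx : 2 * #|P x| <= b * #|nbhd F (P x)|.
  by apply: nbP => p pP; split; [exact: Pz pP | exact: satx].
(* If [D >= 2 b], the vertices of [nbhd F (P x)] are too many to all have
   codegree at least [b]. *)
have [q Aq cq] : exists2 q, q \in nbhd F (P x) & (D < b.*2) || (codegree q < b).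
  have [Db|Db] := ltnP D b.*2.
    suff /card_gt0P[q ?] : 0 < #|nbhd F (P x)| by exists q.
    rewrite lt0n; apply/eqP => A0; rewrite A0 in PPx; nia.
  apply/exists_inP; rewrite -[X in is_true X]negbK negb_exists_in; apply/negP => /forall_inP H.
  have : b * #|nbhd F (P x)| <= \sum_(q in nbhd F (P x)) codegree q.
    rewrite mulnC -sum_nat_const; apply: leq_sum => q qA.
    by rewrite leqNgt; apply: contra (H q qA) => ->; rewrite orbT.
  have : codegree x + \sum_(q in nbhd F (P x)) codegree q <= \sum_(q | q != z) codegree q.
    rewrite (bigD1 x xz) /= leq_add2l big_mkcond [X in _ <= X]big_mkcond /=.
    apply: leq_sum => q _; case: ifP => //; rewrite inE => /exists_inP[p pP Fpq].
    rewrite ifT //; apply/andP; split.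
      by apply: contraTneq (FG _ _ Fpq) => ->; rewrite sG Gz.
    by apply: contraTneq pP => qx; subst q; rewrite inE sF Fpq andbF.
  (* With [sumc], [Px] and [codegree x <= D], the two sums would force [D < 2 b]. *)
  by lia.
move: (Aq); rewrite inE => /exists_inP[p pP Fpq].
have qz : q != z by apply: contraTneq (FG _ _ Fpq) => ->; rewrite sG Gz.
(* Removing [p] ensures [p != s], which the trail needs when [x = y]. *)
have PPy : 2 * #|P y :\ p| <= b * #|nbhd F (P y :\ p)|.
  by apply: nbP => s /setD1P[_ sP]; split; [exact: Pz sP | exact: saty].
have cPy : #|P y| <= #|P y :\ p| + 1 by rewrite (cardsD1 p (P y)) addnC leq_add2l leq_b1.
(* If [D < 2 b], the left side is at most [3 b]. If [codegree q < b], it is at most [2 b], while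
   [codegree y] is below half of [#|T|]. In both cases [nb] makes the right side larger. *)
have big : degree F q + codegree q + 1 < #|nbhd F (P y :\ p)|.
  rewrite ltnNge; apply/negP; move: (dFb q) (cD qz) PPy cPy Py cy cyD nb b2.
  by case/orP: cq; clear; nia.
have [r rB] : exists2 r, r \in nbhd F (P y :\ p) & [&& r != q, G q r & ~~ F q r].
  apply/exists_inP; rewrite -[X in is_true X]negbK negb_exists_in; apply/negP => /forall_inP H.
  move: big; rewrite ltnNge => /negP; apply.
  suff /subset_leq_card : nbhd F (P y :\ p) \subset q |: ([set u | F q u] :|:
      [set u | [&& u != q, u != z & ~~ G q u]]).
    move=> le; apply: leq_trans le _; rewrite (leq_trans (leq_card_setU _ _)) //.
    by rewrite cards1 addnC leq_add2r (leq_trans (leq_card_setU _ _)).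
  apply/subsetP => r rB; have := H r rB; rewrite !inE.
  have rz : r != z.
    by move: rB; rewrite inE => /exists_inP[s _ /FG Gsr]; apply: contraTneq Gsr => ->; rewrite sG Gz.
  by rewrite rz /=; case: (r == q) (F q r) (G q r) => [] [] [].
case/and3P=> rq Gqr Fqr; move: rB; rewrite inE => /exists_inP[s /setD1P[sp sP] Fsr].
move: pP sP; rewrite !inE => /andP[Gxp Fxp] /andP[Gys Fys].
have [||||F' [sF' F'G E]] := toggle_trail sF sG iG FG Gxp Fxp Fpq Gqr Fqr (y := y) (s := s).
- by rewrite sF.
- by rewrite sG.
- by rewrite sF.
- have [_|xy] /= := eqVneq x y; first by rewrite eq_sym.
  rewrite orbF; apply: contra noadd => Gxy; apply/existsP; exists y.
  by rewrite Gxy.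
exists F'; first split => //.
  move=> v; rewrite E; have [vx|_] := eqVneq v x.
    by rewrite vx; move: hx; clear; lia.
  have [vy|_] := eqVneq v y; first by rewrite vy; move: hy; clear; lia.
  by rewrite !addn0.
under eq_bigr do rewrite E; rewrite big_split big_split /=; congr (_ + _).
by rewrite -!big_mkcond !sum1_card !card1.
Qed.

(** A total deficiency of two is found at two vertices or twice at one; the latter gives [x = y]. *)
Lemma subfactor_deficient F : \sum_v degree F v + 2 <= \sum_v h v -> subfactor F ->
  exists x y, degree F x + 1 + (x == y) <= h x /\ degree F y + 1 + (x == y) <= h y.
Proof.
move=> lt [_ _ dF].
have [/existsP[x hx]|] := boolP [exists x, degree F x < h x]; last first.
  rewrite negb_exists => /forallP H; have : \sum_v h v <= \sum_v degree F v.
    by apply: leq_sum => v _; rewrite leqNgt.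
  by lia.
have [hx2|hx2] := leqP (degree F x + 2) (h x).
  by exists x, x; rewrite eqxx; lia.
have [/existsP[y /andP[xy hy]]|] := boolP [exists y, (x != y) && (degree F y < h y)].
  by exists x, y; rewrite (negPf xy); lia.
rewrite negb_exists => /forallP H; have : \sum_(v | v != x) h v <= \sum_(v | v != x) degree F v.
  by apply: leq_sum => v vx; move: (H v); rewrite eq_sym vx /= -leqNgt.
by move: lt; rewrite (bigD1 x) //= [X in _ <= X](bigD1 x) //=; lia.
Qed.

(** Start from the empty graph. Each augmentation raises the degree sum by two, so an even total
    demand is met exactly. *)
Lemma dense_factor : ~~ odd (\sum_v h v) -> exists F, [/\ symmetric F,
  forall u v, F u v -> G u v & forall v, degree F v = h v].
Proof.
move=> ev.
have step m F : subfactor F -> \sum_v h v = \sum_v degree F v + m.*2 ->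
    exists2 F', subfactor F' & \sum_v h v = \sum_v degree F' v.
  elim: m F => [|m IH] F vF E; first by exists F; rewrite ?E ?addn0.
  have [|x [y [hx hy]]] := @subfactor_deficient F _ vF; first by rewrite E; lia.
  by have [F' vF' E'] := subfactor_augment vF hx hy; apply: (IH F') => //; lia.
have d0 v : degree (fun _ _ : T => false) v = 0.
  by rewrite /degree; apply: eq_card0 => u; rewrite inE.
have [||F' [sF FG dF] E] := step (\sum_v h v)./2 (fun _ _ => false).
- by split => // v; rewrite d0.
- under [X in X + _]eq_bigr do rewrite d0.
  by rewrite [X in _ = X + _]big1 // add0n even_halfK.
exists F'; split=> // v; apply/eqP; rewrite eqn_leq dF leqNgt /=; apply/negP => lt.
have : \sum_(u | u != v) degree F' u <= \sum_(u | u != v) h u by apply: leq_sum.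
by move: E; rewrite (bigD1 v) //= [RHS](bigD1 v) //=; lia.
Qed.
End Dense.

(** * Spectral bounds *)

Section Spectral.
Variable R : rcfType.
Local Open Scope ring_scope.

Lemma adjmx_eigenP n (G : rel 'I_n) (r : R) : eigenvalue (adjmx R G) r <->
  exists v : 'I_n -> R, (exists i, v i != 0) /\
    forall j, \sum_i v i * (G i j)%:R = r * v j.
Proof.
split=> [/eigenvalueP[v vA /rV0Pn[i vi]]|[v [[i vi] vA]]].
  exists (v 0); split; first by exists i.
  move=> j; have /rowP/(_ j) := vA; rewrite !mxE => <-.
  by apply: eq_bigr => k _; rewrite mxE.
apply/eigenvalueP; exists (\row_j v j).
  by apply/rowP => j; rewrite !mxE -vA; apply: eq_bigr => k _; rewrite !mxE.
by apply/rV0Pn; exists i; rewrite mxE.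
Qed.

(* Hong's bound, from the largest row sum of the square of the adjacency matrix. *)
Lemma eigenvalue_sqr_le n (G : rel 'I_n) (r : R) : symmetric G -> irreflexive G ->
  (forall v, 0 < degree G v)%N -> eigenvalue (adjmx R G) r ->
  r ^+ 2 + n%:R <= (\sum_v degree G v + 1)%:R.
Proof.
move=> sG iG dG /adjmx_eigenP[v [[i0 vi0] vA]].
have [u _ umax] := @Order.TotalTheory.arg_maxP _ _ _ i0 xpredT (fun i => `|v i|) isT.
have vu : 0 < `|v u| by apply: lt_le_trans (umax i0 isT); rewrite normr_gt0.
have natsum (F : rel 'I_n) j : \sum_i (F i j)%:R = (\sum_i F i j)%N%:R :> R.
  by rewrite natr_sum.
have degR j : \sum_i (G i j)%:R = (degree G j)%:R :> R.
  by rewrite natsum degreeE; congr _%:R; apply: eq_bigr => i _; rewrite sG.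
have bnd j : `|r * v j| <= `|v u| * (degree G j)%:R.
  rewrite -vA (le_trans (ler_norm_sum _ _ _)) // -degR mulr_sumr.
  apply: ler_sum => i _; rewrite normrM normr_nat.
  by apply: ler_wpM2r => //; exact: umax.
have r2 : r ^+ 2 <= (\sum_(j | G j u) degree G j)%N%:R.
  rewrite -(ler_pM2l vu) natr_sum mulr_sumr.
  rewrite -[r ^+ 2]ger0_norm ?sqr_ge0 // -normrM mulrC expr2 -mulrA -vA mulr_sumr.
  apply: le_trans (ler_norm_sum _ _ _) _; rewrite [leRHS]big_mkcond.
  apply: ler_sum => j _; rewrite mulrA normrM normr_nat; case: (G j u).
    by rewrite mulr1.
  by rewrite mulr0.
apply: le_trans (lerD r2 (lexx _)) _; rewrite -natrD ler_nat.
rewrite [X in (_ <= X + _)%N](bigID (fun j => G j u)) /= -addnA leq_add2l.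
(* The summand [n] is [degree G u] plus the number of non-neighbours of [u]. Positive degrees pay
   for all of these except [u] itself, which costs the final 1. *)
have : (degree G u + #|[pred j | ~~ G j u]| = n)%N.
  rewrite -[RHS]card_ord -(cardC [pred j | G j u]); congr (_ + _)%N.
  by rewrite /degree cardsE; apply: eq_card => j; rewrite !inE sG.
have : (#|[pred j | ~~ G j u]| <= \sum_(j | ~~ G j u && (j != u)) degree G j + 1)%N.
  rewrite -sum1_card (bigD1 u) /= ?inE ?iG // addnC leq_add2r.
  by apply: leq_sum => j _; apply: dG.
move=> le eqn; rewrite (bigD1 u) ?iG //=.
by rewrite -[X in (X <= _)%N]eqn -addnA leq_add2l.
Qed.

Lemma Hnb_eigenvector n b : (2 <= b)%N -> (b < n)%N ->
  exists (l : R) (w : 'I_n -> R), [/\ n%:R - 2 <= l, forall i, 0 < w i &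
    forall j, \sum_i w i * (Hnb b i j)%:R = l * w j].
Proof.
move=> b2 bn; pose N : R := n%:R; pose B : R := b%:R.
have hB : 2 <= B by rewrite ler_nat.
have hN : B + 1 <= N by rewrite natr1 ler_nat.
(* The characteristic polynomial of the quotient matrix of the partition
   [K_(b-1)], [K_1], [K_(n-b)]. *)
pose p : {poly R} := 'X * ('X - (B - 2)%:P) * ('X - (N - B - 1)%:P)
  - (B - 1) *: ('X - (N - B - 1)%:P) - ((N - B) * (B - 1)) *: 'X.
have pE x : p.[x] = x * (x - (B - 2)) * (x - (N - B - 1))
  - (B - 1) * (x - (N - B - 1)) - (N - B) * (B - 1) * x.
  by rewrite !hornerE.
have [||l /andP[lN _] /rootP] := @poly_ivt R p (N - 2) N.
- by lra.
(* The value of [p] at [N - 2] is [-(B - 1)^2]. *)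
- rewrite !pE; apply/andP; split; nra.
rewrite pE => pl; pose t := l - (N - B - 1).
have l0 : 0 < l by lra.
have t0 : 0 < t by rewrite /t; lra.
(* The rows of [K_1] and [K_(n-b)] read [l y = (B - 1) x] and [t y' = (B - 1) x]; scaling to
   [x = l t] clears denominators. The remaining row is [pl]. *)
pose x := l * t; pose y := (B - 1) * t; pose y' := (B - 1) * l.
pose w (i : 'I_n) := if (i < b.-1)%N then x else if i == b.-1 :> nat then y else y'.
exists l, w.
have b1n : (b.-1 < n)%N by lia.
pose c := Ordinal b1n.
have xp : 0 < x by apply: mulr_gt0.
have yp : 0 < y by apply: mulr_gt0 => //; lra.
have yp' : 0 < y' by apply: mulr_gt0 => //; lra.
have B1 : b.-1%:R = B - 1 by rewrite /B -[in RHS](@prednK b) ?(ltnW b2) // -natr1 addrK.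
have sum_hub : \sum_(i < n) (i < b.-1)%N%:R = B - 1 :> R.
  rewrite -natr_sum -B1; congr _%:R.
  by rewrite -big_mkcond (big_ord_narrow (ltnW b1n)) sum1_card card_ord.
have sum_pt (j : 'I_n) (f : 'I_n -> R) : \sum_i f i * (i == j)%:R = f j.
  by rewrite (bigD1 j) //= eqxx mulr1 big1 ?addr0 // => i /negPf ->; rewrite mulr0.
have wE i : w i = y' + (x - y') * (i < b.-1)%N%:R + (y - y') * (i == c)%:R.
  rewrite /w -[i == c]/(i == b.-1 :> nat); case: ltngtP => _; rewrite /=; ring.
have bb : (b <= b.-1)%N = false by move: b2; clear; lia.
have wc : w c = y by rewrite /w /= ltnn eqxx.
have W : \sum_i w i = (B - 1) * x + y + (N - B) * y'.
  under eq_bigr do rewrite wE.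
  rewrite !big_split /= (sum_pt c (fun=> _)) sumr_const card_ord -mulr_sumr sum_hub.
  by rewrite -mulr_natl -/N; ring.
split=> // [i|j]; first by rewrite /w; case: ifP => _ //; case: ifP.
have [jb|bj|jb] := ltngtP j b.-1.
- rewrite (eq_bigr (fun i => w i - w i * (i == j)%:R)) => [|i _]; last first.
    by rewrite /Hnb jb /= orbT andbT; case: (i == j) => /=; ring.
  by rewrite big_split /= sumrN sum_pt W /w jb /x /y /y' /t; lra.
- have jE : w j = y' by rewrite /w ltnNge (ltnW bj) /= gtn_eqF.
  have jc : (c == j) = false by rewrite -val_eqE /= ltn_eqF.
  rewrite (eq_bigr (fun i => w i - w i * (i == j)%:R - w i * (i == c)%:R)) => [|i _]; last first.
    rewrite /Hnb [(j < _)%N]ltnNge (ltnW bj) /=.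
    have -> : (b <= j)%N by move: bj; clear; lia.
    rewrite andbT; have [->|ij] := eqVneq i j; first by rewrite eq_sym jc /=; ring.
    have [->|ic] := eqVneq i c; first by rewrite /= ltnn bb /=; ring.
    have -> : ((i < b.-1) || (b <= i))%N.
      by move: ic; rewrite -val_eqE /=; clear; lia.
    by rewrite /=; ring.
  rewrite !big_split /= !sumrN !sum_pt W wc jE /x /y /y' /t; lra.
- have jc : j = c by apply: val_inj.
  subst j; rewrite (eq_bigr (fun i : 'I_n => x * (i < b.-1)%N%:R)) => [|i _]; last first.
    rewrite /Hnb /= ltnn bb.
    rewrite andbF /= orbF /w; case: ltnP => ib /=; last by rewrite andbF !mulr0.
    rewrite (_ : i != c) //.
    by rewrite -val_eqE /= ltn_eqF.
  by rewrite -mulr_sumr sum_hub wc /x /y; ring.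
Qed.

(** Pointwise, [H|v| >= G|v| >= r|v| >= l|v|], yet the outer terms have the same pairing with the
    positive [w]. Hence all are equal, [|v|] is an eigenvector of [H], and an edge of [H] missing
    from [G] could only meet zeros of [v]. The dominating vertex [c] rules out zeros. *)
Lemma subgraph_eigenvalue n (G H : rel 'I_n) (l r : R) (w : 'I_n -> R) c :
  (forall i j, G i j -> H i j) -> symmetric H -> (forall i, i != c -> H i c) ->
  (forall i, 0 < w i) -> (forall j, \sum_i w i * (H i j)%:R = l * w j) ->
  eigenvalue (adjmx R G) r -> l <= r -> forall i j, G i j = H i j.
Proof.
move=> GH sH Hc w0 wH /adjmx_eigenP[v [[i0 vi0] vA]] lr.
have GHR i j : (G i j)%:R <= (H i j)%:R :> R.
  by rewrite ler_nat; case: (G i j) (GH i j) => // ->.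
have up j : r * `|v j| <= \sum_i `|v i| * (G i j)%:R.
  apply: le_trans (_ : `|r * v j| <= _).
    by rewrite normrM ler_wpM2r // ler_norm.
  rewrite -vA (le_trans (ler_norm_sum _ _ _)) //.
  by apply: ler_sum => i _; rewrite normrM normr_nat.
have sumH : \sum_j w j * (\sum_i `|v i| * (H i j)%:R) = \sum_j w j * (l * `|v j|).
  under eq_bigr do rewrite mulr_sumr.
  rewrite exchange_big /=; apply: eq_bigr => i _.
  rewrite [RHS]mulrCA mulrA -wH mulr_suml; apply: eq_bigr => j _.
  by rewrite sH; ring.
have le1 j : \sum_i `|v i| * (G i j)%:R <= \sum_i `|v i| * (H i j)%:R.
  by apply: ler_sum => i _; apply: ler_wpM2l.
have low j : l * `|v j| <= \sum_i `|v i| * (G i j)%:R.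
  by apply: le_trans (up j); apply: ler_wpM2r.
have sum0 : \sum_j w j * (\sum_i `|v i| * (H i j)%:R - l * `|v j|) = 0.
  by under eq_bigr do rewrite mulrBr; rewrite sumrB sumH subrr.
have ge0 j : 0 <= \sum_i `|v i| * (H i j)%:R - l * `|v j|.
  by rewrite subr_ge0 (le_trans (low j)).
have vH j : \sum_i `|v i| * (H i j)%:R = l * `|v j|.
  have /eqP := psumr_eq0P (fun j _ => mulr_ge0 (ltW (w0 j)) (ge0 j)) sum0 (i := j) isT.
  by rewrite mulf_eq0 gt_eqF //= subr_eq0 => /eqP.
have vG j : \sum_i `|v i| * ((H i j)%:R - (G i j)%:R) = 0.
  under eq_bigr do rewrite mulrBr.
  rewrite sumrB; apply/eqP; rewrite subr_eq0 eq_le le1 andbT.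
  by rewrite vH low.
(* A zero of an eigenvector with nonnegative entries spreads to all [H]-neighbours. *)
have zero k : v k = 0 -> forall i, H i k -> v i = 0.
  move=> vk i Hik; have := vH k; rewrite vk normr0 mulr0 => E.
  have := psumr_eq0P (fun i _ => mulr_ge0 (normr_ge0 (v i)) (ler0n R (H i k))) E (i := i) isT.
  by rewrite Hik mulr1 => /normr0P/eqP.
have vc : v c != 0.
  apply: contraNneq vi0 => vc; have [->|i0c] := eqVneq i0 c; first by rewrite vc.
  by rewrite (zero _ vc _ (Hc _ i0c)).
have vn0 k : v k != 0.
  have [-> //|kc] := eqVneq k c; apply: contraNneq vc => vk.
  by rewrite (zero _ vk) // sH Hc.
move=> i j; have nn k : true -> 0 <= `|v k| * ((H k j)%:R - (G k j)%:R).
  by move=> _; rewrite mulr_ge0 // subr_ge0.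
have /eqP := psumr_eq0P nn (vG j) (i := i) isT.
rewrite mulf_eq0 normr_eq0 (negPf (vn0 i)) /= subr_eq0 eqr_nat.
by case: (G i j) (H i j) => [] [].
Qed.
End Spectral.

(** List the neighbours of [u] first, then the other vertices, and insert [u] at position [b - 1];
    the map sends a vertex to its position. The neighbours of [u], at most [b - 1] many, land in the
    clique [K_(b-1)], and in [Hnb] any two positions other than [b - 1] are adjacent. *)
Lemma low_degree_embedding n b (G : rel 'I_n) u : symmetric G -> irreflexive G ->
  0 < b -> b < n -> degree G u < b ->
  exists2 f : 'I_n -> 'I_n, bijective f & forall x y, G x y -> Hnb b (f x) (f y).
Proof.
move=> sG iG b0 bn du.
pose N := [set v | G u v].
pose L := enum N ++ enum (~: (u |: N)).
pose s := take b.-1 L ++ u :: drop b.-1 L.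
have memL v : (v \in L) = (v != u).
  rewrite mem_cat !mem_enum !inE; case: eqP => [->|_] /=; first by rewrite iG.
  by case: (G u v).
have uL : uniq L.
  rewrite cat_uniq !enum_uniq /= andbT; apply/hasPn => v.
  by rewrite !mem_enum !inE negb_or => /andP[].
have ps : perm_eq s (u :: L) by rewrite /s perm_catC /= perm_cons perm_catC cat_take_drop.
have us : uniq s by rewrite (perm_uniq ps) /= memL eqxx.
have ms v : v \in s by rewrite (perm_mem ps) inE memL; case: eqP.
have ss : size s = n.
  by rewrite -[RHS](size_enum_ord n); apply: perm_size; apply: uniq_perm => // [|v];
    rewrite ?enum_uniq // ms mem_enum.
have sL : size L = n.-1 by have := perm_size ps; rewrite ss /=; clear; lia.
have lt v : index v s < n by have := ms v; rewrite -index_mem ss.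
pose f v := Ordinal (lt v).
have finj : injective f
  by move=> x y /(congr1 val) /= E; rewrite -(nth_index x (ms x)) E nth_index.
have sT : size (take b.-1 L) = b.-1 by rewrite size_takel // sL; lia.
have uT : u \notin take b.-1 L.
  by apply/negP => /mem_take; rewrite memL eqxx.
have fu : f u = b.-1 :> nat by rewrite /= /s index_cat (negPf uT) /= eqxx sT addn0.
have fN v : G u v -> f v < b.-1.
  move=> Guv; have vT : v \in take b.-1 L.
    rewrite take_cat ifN -?leqNgt; last by rewrite -cardE -/(degree G u); lia.
    by rewrite mem_cat mem_enum inE Guv.
  by rewrite /= /s index_cat vT -{2}sT index_mem.
exists f; first exact: injF_bij.
move=> x y Gxy; rewrite /Hnb (inj_eq finj).
have -> : x != y by apply: contraTneq Gxy => ->; rewrite iG.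
rewrite andTb; have [xu|xu] := eqVneq x u; first by subst x; rewrite (fN _ Gxy) orbT.
have [yu|yu] := eqVneq y u; first by subst y; rewrite (fN x) // sG.
have ne v : v != u -> f v <> b.-1 :> nat.
  by move=> vu; rewrite -fu => /val_inj/finj/eqP; rewrite (negPf vu).
move: (ne x xu) (ne y yu); move: (nat_of_ord (f x)) (nat_of_ord (f y)).
by clear; lia.
Qed.

(** * Reduction to a vertex-deleted dense graph *)

Lemma subset_of_card (T : finType) (A : {set T}) k : k <= #|A| ->
  exists2 B : {set T}, B \subset A & #|B| = k.
Proof.
move=> kA; exists [set:: take k (enum A)].
  by apply/subsetP => v; rewrite inE => /mem_take; rewrite mem_enum.
rewrite cardsE (card_uniqP _) ?take_uniq ?enum_uniq // size_takel //.
by rewrite -cardE.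
Qed.

(** The comparison with [Hnb] and the non-isomorphism are used up here; afterwards only the
    eigenvalue bound and the minimum degree matter. *)
Lemma extremal_eigenvector (R : rcfType) n b (G : rel 'I_n) (rG rH : R) :
  simple_graph G -> 1 < b -> b < n -> spectral_radius G rG ->
  spectral_radius (@Hnb n b) rH -> (rH <= rG)%R ->
  ~ graph_iso G (@Hnb n b) ->
  (n%:R - 2 <= rG)%R /\ forall v, b <= degree G v.
Proof.
move=> [sG iG] b1 bn [eG _] [_ maxH] le niso.
have [l [w [nl w0 wH]]] := @Hnb_eigenvector R n b b1 bn.
have n0 : 0 < n by lia.
pose o := Ordinal n0.
have lG : (l <= rG)%R.
  apply: le_trans le; apply: maxH; apply/adjmx_eigenP; exists w; split=> //.
  by exists o; rewrite gt_eqF.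
split; first exact: le_trans lG.
move=> v; rewrite leqNgt; apply/negP => dv; apply: niso.
have [f bf fG] := low_degree_embedding sG iG (ltnW b1) bn dv.
have [g fK gK] := bf; exists f; split=> // x y.
(* [Hnb] is pulled back along [f]. The dominating vertex is the preimage of 0, which lies in
   [K_(b-1)] as [b > 1]. *)
apply: (@subgraph_eigenvalue R n G (fun i j => Hnb b (f i) (f j)) l rG (w \o f) (g o)) => //.
- move=> i j; rewrite /Hnb eq_sym; congr andb.
  by rewrite orbCA [(b <= f j) && _]andbC.
- move=> i io; rewrite /Hnb gK.
  have -> /= : f i != o by apply: contraNneq io => <-; rewrite fK.
  by rewrite (_ : 0 < b.-1) ?orbT //; move: b1; clear; lia.
- by move=> i; apply: w0.
- by move=> j /=; rewrite -wH [RHS](reindex f); [|exact: onW_bij].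
Qed.

Lemma dense_all_factors n a b (G : rel 'I_n) : simple_graph G -> 3 <= a ->
  a < b -> 2 * b ^ 2 + 4 * b <= n -> (forall v, b <= degree G v) ->
  (n - 2) ^ 2 + n <= \sum_v degree G v + 1 -> all_factors G a b.
Proof.
move=> [sG iG] a3 ab nb dG sum h _ hab ev.
have n0 : 0 < n by lia.
have [z _ zmin] := @arg_minnP _ (Ordinal n0) xpredT (degree G) isT.
have [S SG cS] : exists2 S : {set 'I_n}, S \subset [set u | G z u] & #|S| = h z.
  by apply: subset_of_card; apply: leq_trans (dG z); case/andP: (hab z).
have zS : z \notin S by apply/negP => /(subsetP SG); rewrite inE iG.
pose G' : rel 'I_n := fun u v => [&& u != z, v != z & G u v].
(* Each vertex of [S] spends one unit of demand on its edge to [z]; [3 <= a] leaves at least 2. *)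
pose h' v := if v == z then 0 else h v - (v \in S).
have sG' : symmetric G' by move=> u v; rewrite /G' sG andbCA.
have iG' : irreflexive G' by move=> u; rewrite /G' iG !andbF.
have G'z v : G' z v = false by rewrite /G' eqxx.
have hh v : h' v + (v \in S) + (v == z) * h z = h v.
  rewrite /h'; case: eqP => [->|_]; first by rewrite (negPf zS) mul1n.
  by have := hab v; move: a3 (v \in S); clear => a3 [] /=; lia.
have dG' v : v != z -> degree G' v + G v z = degree G v.
  move=> vz; rewrite [RHS](cardsD1 z) inE addnC; congr (_ + _).
  by apply: eq_card => u; rewrite !inE /G' vz.
have cG' v : v != z -> codegree G' z v + degree G v + 2 = n + G v z.
  move=> vz; have := degree_codegree sG' iG' G'z vz.
  by rewrite card_ord -(dG' v vz) => E; rewrite -[in RHS]E; lia.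
have dn v : degree G v + 1 <= n.
  rewrite -[X in _ <= X]card_ord -cardsT (cardsD1 v) inE addnC leq_add2l.
  apply: subset_leq_card; apply/subsetP => u; rewrite !inE andbT => Gvu.
  by apply: contraTneq Gvu => ->; rewrite iG.
(* By [sum], the complement of [G] has degree sum at most [2 n - 3]. Deleting [z] removes twice its
   complement degree [n - 1 - degree G z]. *)
have sumc : \sum_(v | v != z) codegree G' z v + (n - 1 - degree G z).*2 + 3 <= #|'I_n|.*2.
  have : \sum_(v | v != z) (codegree G' z v + degree G v + 2) =
      \sum_(v | v != z) (n + G v z) by apply: eq_bigr => v; apply: cG'.
  have sumz : \sum_(v | v != z) (G v z : nat) = degree G z.
    rewrite degreeE [RHS](bigD1 z) //= iG add0n; apply: eq_bigr => v _.
    by rewrite sG.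
  have cardz : #|[pred v | v != z]| = n - 1.
    by have := cardC1 z; rewrite card_ord subn1.
  rewrite !big_split /= sumz !sum_nat_const cardz card_ord.
  move: sum (dn z); rewrite (bigD1 z) //=; move: nb ab a3.
  move: (\sum_(i | _) codegree _ _ _) (\sum_(i | _) degree _ _) (degree G z).
  by clear; move=> c s d; nia.
have [|||||||F' [sF' FG' dF']] := @dense_factor _ G' h' z b (n - 1 - degree G z) sG' iG' G'z.
- by rewrite /h' eqxx.
- move=> v vz; rewrite /h' (negPf vz); have := hab v; move: a3 (v \in S).
  by clear => a3 [] /=; lia.
- by lia.
- by rewrite card_ord.
- move=> v vz; have := cG' v vz; have := zmin v isT; have := dn v.
  by case: (G v z); clear; lia.
- exact: sumc.
(* The edges at [z] use [h z] units at each end, so parity is preserved. *)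
- have : \sum_v h v = \sum_v h' v + (h z).*2.
    rewrite -(eq_bigr _ (fun v _ => hh v)) !big_split /= -addnA; congr (_ + _).
    rewrite -big_mkcond sum1_card cS (bigD1 z) //= eqxx mul1n big1 ?addn0 ?addnn //.
    by move=> v /negPf ->.
  by move=> E; move: ev; rewrite E oddD odd_double addbF.
have F'z v : F' v z = false by apply/negP => /FG'; rewrite sG' G'z.
exists (fun i j => [|| F' i j, (i == z) && (j \in S) | (j == z) && (i \in S)]).
split; first split.
- by move=> i j; rewrite sF'; congr orb; rewrite orbC.
- move=> i; rewrite (negPf (_ : ~~ F' i i)) /= ?orbb.
    by apply/negP => /andP[/eqP->]; rewrite (negPf zS).
  by apply/negP => /FG'; rewrite iG'.
split=> [x y|v].
  case/or3P => [/FG'/and3P[]|/andP[/eqP-> /(subsetP SG)]|/andP[/eqP-> /(subsetP SG)]] //.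
    by rewrite inE.
  by rewrite inE sG.
rewrite -[RHS]hh -dF'; have [->|vz] := eqVneq v z.
  rewrite (negPf zS) mul1n addn0 -cS (_ : degree F' z = 0); last first.
    by apply: eq_card0 => u; rewrite inE sF' F'z.
  rewrite add0n; apply: eq_card => u; rewrite inE sF' F'z /=.
  by rewrite andbF orbF.
rewrite mul0n addn0 (cardsD1 z) inE F'z eqxx /= addnC; congr (_ + _).
apply: eq_card => u; rewrite !inE /=; have [->|uz] := eqVneq u z; first by rewrite F'z.
by rewrite /= orbF.
Qed.

Theorem theorem1p7 (R : rcfType) (a b n : nat) (G : rel 'I_n) :
  simple_graph G -> (3 <= a)%N -> (a < b)%N -> (2 * b ^ 2 + 4 * b <= n)%N ->
  forall rG rH : R,
    spectral_radius G rG -> spectral_radius (@Hnb n b) rH -> (rH <= rG)%R ->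
    ~ graph_iso G (@Hnb n b) ->
    all_factors G a b.
Proof.
move=> gG a3 ab nb rG rH sG sH le niso.
have b1 : 1 < b by lia.
have bn : b < n by lia.
have [nr dG] := extremal_eigenvector gG b1 bn sG sH le niso.
apply: dense_all_factors => //.
rewrite -(ler_nat R); apply: le_trans (eigenvalue_sqr_le _ _ _ (proj1 sG)).
- rewrite natrD natrX natrB ?lerD2r; last by lia.
  have n2 : (2 <= n%:R :> R)%R by rewrite ler_nat; lia.
  by rewrite lerXn2r ?nnegrE //; lra.
- by case: gG.
- by case: gG.
- by move=> v; apply: leq_trans (dG v); lia.
Qed.
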